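(* For $n\ge 2$, there is a bijection between $\mathrm{UPF}^{\mathrm{T1}}_{n,\{n-1\}}$ and the set of pairs $(\sigma,j)$ with $\sigma$ a permutation of $[n]$ and $j$ an exceedance of $\sigma$. In particular, $|\mathrm{UPF}^{\mathrm{T1}}_{n,\{n-1\}}|=(n-1)\frac{n!}{2}$, which is the total number of exceedances over all permutations of $[n]$.
   Context: A parking preference $(a_1,\dots,a_n)\in[n]^n$ describes $n$ cars entering a one-way street with spots $1,\dots,n$ in the order $1,2,\dots,n$; car $i$ parks in the first unoccupied spot numbered $\ge a_i$. It is a parking function if all cars park. It is a unit interval parking function if it is a parking function and every car $i$ parks in spot $a_i$ or spot $a_i+1$. Car $i$ is lucky if it parks in spot $a_i$. $\mathrm{UPF}^{\mathrm{T1}}_{n,\{n-1\}}$ is the set of unit interval parking functions of length $n$ with exactly $n-1$ lucky cars. An exceedance of a permutation $\sigma$ of $[n]$ is an index $j\in[n]$ with $\sigma(j)>j$. *)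

(* Defs.v *)
(* Cars, spots and permutation indices are numbered from 0: the paper's
   [n] = {1, ..., n} is 'I_n, with k in [n] represented by k - 1. *)
From HB Require Import structures.
From mathcomp Require Import all_boot fingroup perm.
Set Implicit Arguments.
Unset Strict Implicit.
Unset Printing Implicit Defensive.

(* [None] when every spot from [a] to the end of the street is in [occ]. *)
Definition first_free (n : nat) (occ : seq nat) (a : nat) : option nat :=
  ohead [seq s <- iota a (n - a) | s \notin occ].

(* Outcomes of the cars with preferences [prefs], entering in list order when
   the spots in [occ] are taken; [None] is a car that leaves without parking. *)
Fixpoint park (n : nat) (occ : seq nat) (prefs : seq nat) : seq (option nat) :=
  if prefs is a :: prefs' then
    let s := first_free n occ a in
    s :: park n (if s is Some t then t :: occ else occ) prefs'
  else [::].

Definition spot (n : nat) (a : n.-tuple 'I_n) (i : 'I_n) : option nat :=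
  nth None (park n [::] [seq val x | x <- a]) i.

Definition parking_function (n : nat) (a : n.-tuple 'I_n) : bool :=
  [forall i : 'I_n, spot a i != None].

Definition lucky (n : nat) (a : n.-tuple 'I_n) (i : 'I_n) : bool :=
  spot a i == Some (val (tnth a i)).

Definition unit_interval_pf (n : nat) (a : n.-tuple 'I_n) : bool :=
  parking_function a &&
  [forall i : 'I_n, (spot a i == Some (val (tnth a i))) ||
                    (spot a i == Some (val (tnth a i)).+1)].

Definition UPF (n k : nat) : {set n.-tuple 'I_n} :=
  [set a : n.-tuple 'I_n |
    unit_interval_pf a && (#|[set i : 'I_n | lucky a i]| == k)].

Definition exceedances (n : nat) (sigma : 'S_n) : {set 'I_n} :=
  [set j : 'I_n | j < sigma j].

Definition exceedance_pairs (n : nat) : {set 'S_n * 'I_n} :=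
  [set p : 'S_n * 'I_n | p.2 \in exceedances p.1].

(* Main.v *)
(** A unit interval parking function with a single unlucky car [u] is determined
    by the permutation [tau] listing the cars spot by spot, together with the
    spot [s.+1] in which [u] parks: every other car prefers its own spot, and [u]
    prefers spot [s].  Car [u] is pushed forward exactly when the car in spot [s]
    came earlier, that is, when [tau] has an ascent at [s].  Composing with an
    adjacent transposition shows that half of the permutations have an ascent at
    a given place.  Exceedances are counted from the fact that [sigma j = k] for
    [n.-1`!] permutations [sigma], whatever [j] and [k]. *)
Require Import Defs.
From mathcomp Require Import all_boot fingroup perm.

Set Implicit Arguments.
Unset Strict Implicit.
Unset Printing Implicit Defensive.

(** * Parking outcomes *)

Lemma first_freeP (n : nat) (occ : seq nat) (a s : nat) :
  first_free n occ a = Some s <->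
  [/\ a <= s < n, s \notin occ & forall t, a <= t < s -> t \in occ].
Proof.
rewrite /first_free; have [le_na | lt_an] := leqP n a.
  have /eqP -> : n - a == 0 by rewrite subn_eq0.
  split=> //= -[/andP[le_as lt_sn] _ _].
  by have := leq_trans lt_sn (leq_trans le_na le_as); rewrite ltnn.
(* With the end of the street written as [a + k], induction on [k] moves the start [a] forward and
   keeps the end fixed. *)
move: (n - a) (subnKC (ltnW lt_an)) => k <- {n lt_an}.
elim: k a => [|k IHk] a /=.
  rewrite addn0; split=> // -[/andP[le_as lt_sa] _ _].
  by have := leq_trans lt_sa le_as; rewrite ltnn.
rewrite -addSnnS; case: ifP => [a_free | /negbFE a_occ] /=.
  split=> [[<-] | [/andP[le_as _] s_free before]].
    split=> //; first by rewrite leqnn addSnnS addnS ltnS leq_addr.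
    by move=> t /andP[le_at lt_ta]; have := leq_trans lt_ta le_at; rewrite ltnn.
  congr Some; apply/eqP; rewrite eqn_leq le_as leqNgt; apply/negP => lt_as.
  by move: a_free; rewrite before // leqnn lt_as.
split=> [/(IHk a.+1)[/andP[lt_as lt_sk] s_free before] |].
  split=> //; first by rewrite (ltnW lt_as).
  move=> t /andP[]; rewrite leq_eqVlt => /orP[/eqP <- // | lt_at] lt_ts.
  by apply: before; rewrite lt_at.
case=> /andP[le_as lt_sk] s_free before; apply/(IHk a.+1); split=> //.
  rewrite lt_sk andbT ltn_neqAle le_as andbT; apply/eqP => eq_as.
  by rewrite -eq_as a_occ in s_free.
by move=> t /andP[lt_at lt_ts]; apply: before; rewrite ltnW.
Qed.

Lemma eq_first_free (n : nat) (occ occ' : seq nat) (a : nat) :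
  occ =i occ' -> first_free n occ a = first_free n occ' a.
Proof.
by move=> eq_occ; congr ohead; apply: eq_filter => s; rewrite eq_occ.
Qed.

Lemma size_park (n : nat) (occ prefs : seq nat) :
  size (park n occ prefs) = size prefs.
Proof. by elim: prefs occ => //= a prefs IH occ; rewrite IH. Qed.

(** [park] accumulates the taken spots in reverse order of arrival, which is harmless because
    [first_free] depends only on membership. *)
Lemma nth_park (n : nat) (occ prefs : seq nat) (i : nat) :
  i < size prefs ->
  nth None (park n occ prefs) i =
  first_free n (pmap id (take i (park n occ prefs)) ++ occ) (nth 0 prefs i).
Proof.
elim: prefs occ i => //= a prefs IH occ [|i] //= lt_i.
rewrite IH //; apply: eq_first_free => s.
case: (first_free n occ a) => [t|] //=.
by rewrite !(inE, mem_cat) orbCA.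
Qed.

(** Restates parking without recursion; all later reasoning about outcomes goes through this
    characterization. *)
Lemma spotP (n : nat) (a : n.-tuple 'I_n) (i : 'I_n) (s : nat) :
  spot a i = Some s <->
  [/\ tnth a i <= s < n,
      forall j : 'I_n, j < i -> spot a j <> Some s
    & forall t, tnth a i <= t < s -> exists2 j : 'I_n, j < i & spot a j = Some t].
Proof.
have size_a : size [seq val x | x <- a] = n by rewrite size_map size_tuple.
have occP t : reflect (exists2 j : 'I_n, j < i & spot a j = Some t)
    (t \in pmap id (take i (park n [::] [seq val x | x <- a])) ++ [::]).
  rewrite cats0 mem_pmap map_id; apply: (iffP (nthP None)).
    move=> [j]; rewrite size_takel ?size_park ?size_a // => [lt_ji|]; last exact: ltnW.
    rewrite nth_take // => eq_t.
    by exists (Ordinal (ltn_trans lt_ji (ltn_ord i))).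
  move=> [j lt_ji eq_t]; exists j; last by rewrite nth_take.
  by rewrite size_takel ?size_park ?size_a // ltnW.
rewrite {1}/spot nth_park ?size_a //.
have -> : nth 0 [seq val x | x <- a] i = tnth a i.
  by rewrite (nth_map (tnth a i)) ?size_tuple // -tnth_nth.
split=> [/first_freeP[a_le_s s_free before] | [a_le_s s_free before]].
  split=> // [j lt_ji eq_s | t /before /occP //].
  by case/occP: s_free; exists j.
apply/first_freeP; split=> // [|t /before /occP //].
by apply/occP => -[j /s_free].
Qed.

Lemma spot_inj (n : nat) (a : n.-tuple 'I_n) (i j : 'I_n) (s : nat) :
  spot a i = Some s -> spot a j = Some s -> i = j.
Proof.
move=> spot_i spot_j; apply: val_inj => /=.
case: (ltngtP i j) => // lt_ij.
  by case/spotP: spot_j => _ /(_ i lt_ij).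
by case/spotP: spot_i => _ /(_ j lt_ij).
Qed.

(** No two cars share a spot, so the outcome is an injection of a finite set into itself. Here [p]
    sends cars to spots, the inverse direction of the [tau] used below. *)
Lemma parking_function_perm (n : nat) (a : n.-tuple 'I_n) :
  parking_function a ->
  exists p : 'S_n, forall i, spot a i = Some (val (p i)).
Proof.
move=> /forallP parks.
have spot_ord i : exists s : 'I_n, spot a i == Some (val s).
  have := parks i; case eq_s: (spot a i) => [s|] // _.
  have lt_sn : s < n by case/spotP: eq_s => /andP[].
  by exists (Ordinal lt_sn).
pose f i := xchoose (spot_ord i).
have fP i : spot a i = Some (val (f i)) by apply/eqP/(xchooseP (spot_ord i)).
have f_inj : injective f.
  by move=> i j eq_f; apply: (@spot_inj _ a i j (f i)); rewrite fP // eq_f.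
by exists (perm f_inj) => i; rewrite permE.
Qed.

(** * Ascents *)

Definition asc_lo (m : nat) (s : 'I_m) : 'I_m.+1 := widen_ord (leqnSn m) s.
Definition asc_hi (m : nat) (s : 'I_m) : 'I_m.+1 := lift ord0 s.

Definition ascent_pairs (m : nat) : {set 'S_m.+1 * 'I_m} :=
  [set p : 'S_m.+1 * 'I_m | p.1 (asc_lo p.2) < p.1 (asc_hi p.2)].

Lemma val_asc_hi (m : nat) (s : 'I_m) : val (asc_hi s) = s.+1.
Proof. by rewrite /= /bump leq0n. Qed.

Lemma asc_lo_neq_hi (m : nat) (s : 'I_m) : asc_lo s != asc_hi s.
Proof. by rewrite -val_eqE val_asc_hi /= neq_ltn ltnSn. Qed.

Lemma card_ascent_at (m : nat) (s : 'I_m) :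
  #|[set tau : 'S_m.+1 | tau (asc_lo s) < tau (asc_hi s)]| = (m.+1)`! %/ 2.
Proof.
set A := [set tau : 'S_m.+1 | _].
pose t := tperm (asc_lo s) (asc_hi s).
have cardAC : #|~: A| = #|A|.
  (* Products act left factor first, so [t * tau] is [tau] with its values at the two positions
     exchanged. Those values differ, so a non-ascent becomes an ascent. *)
  rewrite -[RHS](card_preimset _ (mulgI t)).
  apply: eq_card => tau; rewrite !inE !permM tpermL tpermR -leqNgt leq_eqVlt.
  by rewrite val_eqE (inj_eq perm_inj) eq_sym (negbTE (asc_lo_neq_hi s)).
have : #|A| + #|~: A| = (m.+1)`!.
  by rewrite cardsC card_Sn.
by rewrite cardAC addnn -mul2n => <-; rewrite mulKn.
Qed.

Lemma card_ascent_pairs (m : nat) : #|ascent_pairs m| = m * ((m.+1)`! %/ 2).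
Proof.
rewrite -sum1_card.
rewrite (eq_bigl (fun p : 'S_m.+1 * 'I_m =>
    predT p.1 && (p.1 (asc_lo p.2) < p.1 (asc_hi p.2)))); last first.
  by move=> p; rewrite inE.
rewrite -(pair_big_dep predT (fun (tau : 'S_m.+1) s => tau (asc_lo s) < tau (asc_hi s))
  (fun _ _ => 1)) /= (exchange_big_dep predT) //=.
under eq_bigr => s _ do rewrite sum1dep_card card_ascent_at.
by rewrite sum_nat_const card_ord.
Qed.

(** * Unit interval parking functions with one unlucky car *)

Definition ascent_pref (m : nat) (p : 'S_m.+1 * 'I_m) : (m.+1).-tuple 'I_m.+1 :=
  [tuple if i == p.1 (asc_hi p.2) then asc_lo p.2 else (p.1^-1)%g i | i < m.+1].

Section AscentPref.

Variables (m : nat) (tau : 'S_m.+1) (s : 'I_m).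
Hypothesis asc : tau (asc_lo s) < tau (asc_hi s).
Let a := ascent_pref (tau, s).

(** Strong induction on arrival order: the earlier cars already stand in their assigned spots, so
    the spot assigned to [i] is still free. *)
Lemma spot_ascent_pref (i : 'I_m.+1) : spot a i = Some (val ((tau^-1)%g i)).
Proof.
have [k] := ubnP (val i); elim: k i => // k IH i /ltnSE le_ik.
have earlier (j : 'I_m.+1) : j < i -> spot a j = Some (val ((tau^-1)%g j)).
  by move=> lt_ji; apply: IH; apply: leq_trans lt_ji le_ik.
apply/spotP; split.
- rewrite ltn_ord andbT tnth_mktuple /=; case: eqP => [-> | _] //.
  by rewrite permK val_asc_hi leqnSn.
- move=> j lt_ji; rewrite earlier // => -[/val_inj/perm_inj eq_ji].
  by rewrite eq_ji ltnn in lt_ji.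
move=> t; rewrite tnth_mktuple /=; case: eqP => [eq_i | _]; last first.
  by case/andP=> le_t /(leq_ltn_trans le_t); rewrite ltnn.
(* The unlucky car passes over spot [s] only; the ascent says that the car assigned there came
   earlier. *)
rewrite eq_i permK val_asc_hi ltnS -eqn_leq => /eqP <-.
have lt_lo : tau (asc_lo s) < i by rewrite eq_i.
by exists (tau (asc_lo s)); rewrite // earlier // permK.
Qed.

Lemma lucky_ascent_pref (i : 'I_m.+1) : lucky a i = (i != tau (asc_hi s)).
Proof.
rewrite /lucky spot_ascent_pref tnth_mktuple /=.
case: (eqVneq i (tau (asc_hi s))) => [-> | _] /=; last by rewrite eqxx.
by rewrite permK (inj_eq (@Some_inj _)) val_asc_hi eqn_leq ltnn.
Qed.

Lemma ascent_pref_UPF : a \in UPF m.+1 m.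
Proof.
rewrite inE /unit_interval_pf -andbA; apply/and3P; split.
- by apply/forallP => i; rewrite spot_ascent_pref.
- apply/forallP => i; rewrite spot_ascent_pref tnth_mktuple /=.
  case: (eqVneq i (tau (asc_hi s))) => [-> | _]; last by rewrite eqxx.
  by rewrite permK val_asc_hi eqxx orbT.
rewrite (_ : [set i | lucky a i] = [set~ tau (asc_hi s)]).
  by rewrite cardsC1 card_ord.
by apply/setP => i; rewrite !inE lucky_ascent_pref.
Qed.

End AscentPref.

(** The outcome recovers [tau], and the only unlucky car, [tau (asc_hi s)], then recovers [s]. *)
Lemma ascent_pref_inj (m : nat) :
  {in ascent_pairs m &, injective (@ascent_pref m)}.
Proof.
move=> [tau s] [tau' s']; rewrite !inE /= => asc asc' eq_a.
have eq_tau : tau = tau'.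
  apply: invg_inj; apply/permP => i; apply: val_inj; apply: Some_inj.
  by rewrite -(spot_ascent_pref asc) -(spot_ascent_pref asc') eq_a.
congr pair => //; apply: (@lift_inj _ ord0); apply: (@perm_inj _ tau).
apply/eqP; rewrite -[_ == _]negbK {2}eq_tau.
by rewrite -(lucky_ascent_pref asc') -eq_a (lucky_ascent_pref asc) eqxx.
Qed.

Lemma UPF_ascent_pref (m : nat) (a : (m.+1).-tuple 'I_m.+1) :
  a \in UPF m.+1 m -> exists2 p, p \in ascent_pairs m & a = ascent_pref p.
Proof.
rewrite inE => /andP[/andP[/parking_function_perm[p spot_a] /forallP unit_a]].
move=> /eqP card_lucky.
have /cards1P[u unlucky] : #|~: [set i | lucky a i]| == 1.
  by rewrite cardsCs setCK card_lucky card_ord subSnn.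
have luckyE i : lucky a i = (i != u).
  by move/setP/(_ i): unlucky; rewrite !inE => <-; rewrite negbK.
have pu : val (p u) = (tnth a u).+1.
  have := unit_a u; rewrite -[_ == Some (val _)]/(lucky a u) luckyE eqxx /=.
  by rewrite spot_a => /eqP[].
(* Car [u] parks one past its preference, which is therefore not the last spot and can serve as the
   place of an ascent. *)
have lt_am : tnth a u < m by rewrite -ltnS -pu ltn_ord.
pose s := Ordinal lt_am.
have hiE : asc_hi s = p u by apply: val_inj; rewrite val_asc_hi pu.
have loE : asc_lo s = tnth a u by apply: val_inj.
exists ((p^-1)%g, s).
  rewrite inE /= hiE permK loE.
  (* The spot that [u] prefers but does not get was taken by an earlier car; this is the ascent. *)
  case/spotP: (spot_a u) => _ _ /(_ (tnth a u)).
  rewrite pu leqnn ltnSn => /(_ isT)[j lt_ju].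
  by rewrite spot_a => -[/val_inj <-]; rewrite permK.
apply: eq_from_tnth => i; rewrite tnth_mktuple /= hiE permK loE invgK.
case: (eqVneq i u) => [-> // | i_neq_u].
have : lucky a i by rewrite luckyE.
by rewrite /lucky spot_a => /eqP[/val_inj].
Qed.

Lemma card_UPF_one_unlucky (m : nat) : #|UPF m.+1 m| = m * ((m.+1)`! %/ 2).
Proof.
rewrite -card_ascent_pairs -(card_in_imset (@ascent_pref_inj m)).
apply: eq_card => a; apply/idP/imsetP; first exact: UPF_ascent_pref.
by move=> [[tau s]]; rewrite inE => asc ->; apply: ascent_pref_UPF.
Qed.

(** * Exceedances *)

(** Composing with the transposition of [k] and [l] matches the permutations with value [l] at [j]
    to those with value [k]. The [m.+1] classes thus have equal size and together exhaust the
    group. *)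
Lemma card_perm_value (m : nat) (j k : 'I_m.+1) :
  #|[set sigma : 'S_m.+1 | sigma j == k]| = m`!.
Proof.
have same_card l :
    #|[set sigma : 'S_m.+1 | sigma j == l]| = #|[set sigma : 'S_m.+1 | sigma j == k]|.
  rewrite -[RHS](card_preimset _ (mulIg (tperm k l))); apply: eq_card => sigma.
  by rewrite !inE permM (canF_eq (tpermK k l)) tpermL.
apply/eqP; rewrite -(eqn_pmul2l (ltn0Sn m)) -factS -card_Sn; apply/eqP.
rewrite -[RHS]sum1_card (partition_big (fun sigma : 'S_m.+1 => sigma j) predT) //=.
under [RHS]eq_bigr => l _ do rewrite sum1dep_card same_card.
by rewrite sum_nat_const card_ord.
Qed.

Lemma sum_exceedances (m : nat) :
  \sum_(sigma : 'S_m.+1) #|exceedances sigma| = m * ((m.+1)`! %/ 2).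
Proof.
transitivity (\sum_(k < m.+1) k * m`!).
  under eq_bigr => sigma _ do rewrite -sum1dep_card
    (partition_big sigma predT) //=.
  rewrite exchange_big; apply: eq_bigr => k _ /=.
  rewrite (exchange_big_dep (fun j : 'I_m.+1 => j < k)) /=; last first.
    by move=> sigma j _ /andP[lt_j /eqP <-].
  transitivity (\sum_(j < m.+1 | j < k) m`!).
    apply: eq_bigr => j lt_jk; rewrite -(card_perm_value j k) -sum1dep_card.
    by apply: eq_bigl => sigma; case: eqP => [-> | _]; rewrite ?lt_jk ?andbF.
  rewrite -(big_ord_widen _ (fun=> m`!) (ltnW (ltn_ord k))).
  by rewrite sum_nat_const card_ord.
rewrite -big_distrl /= -(big_mkord predT id) bin2_sum bin2 /=.
have even_mm : ~~ odd (m.+1 * m) by rewrite oddM /= andNb.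
case: m even_mm => [|m] even_mm; first by rewrite mul0n.
have dvd2 : 2 %| (m.+2)`! by apply: dvdn_fact.
by rewrite -divn2 divn_mulAC ?dvdn2 // muln_divA // factS mulnAC mulnC.
Qed.

Lemma card_exceedance_pairs (n : nat) :
  #|exceedance_pairs n| = \sum_(sigma : 'S_n) #|exceedances sigma|.
Proof.
under eq_bigr => sigma _ do rewrite -sum1_card.
by rewrite pair_big_dep -sum1_card; apply: eq_bigl => p; rewrite inE.
Qed.

(** Elements of equal rank in the two enumerations are matched; the bijection of the theorem thus
    comes from equal counts, not from an explicit correspondence. *)
Lemma eq_card_bij (T T' : finType) :
  #|T| = #|T'| -> exists f : T -> T', bijective f.
Proof.
move=> eq_T; exists (fun x => enum_val (cast_ord eq_T (enum_rank x))).
exists (fun y => enum_val (cast_ord (esym eq_T) (enum_rank y))) => x.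
  by rewrite enum_valK cast_ordK enum_rankK.
by rewrite enum_valK cast_ordKV enum_rankK.
Qed.

(* n`! is even for 1 < n, so n`! %/ 2 is the exact quotient. *)
Theorem theorem3p21 (n : nat) (n_ge2 : 2 <= n) :
  (exists f : {a : n.-tuple 'I_n | a \in UPF n (n - 1)} ->
              {p : 'S_n * 'I_n | p \in exceedance_pairs n}, bijective f)
  /\ #|UPF n (n - 1)| = (n - 1) * (n`! %/ 2)
  /\ \sum_(sigma : 'S_n) #|exceedances sigma| = (n - 1) * (n`! %/ 2).
Proof.
case: n n_ge2 => // m _; rewrite subn1 /=.
split; last by rewrite card_UPF_one_unlucky sum_exceedances.
have eq_cards : #|{: {a | a \in UPF m.+1 m}}| =
                #|{: {p | p \in exceedance_pairs m.+1}}|.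
  rewrite !card_sig [LHS]card_UPF_one_unlucky.
  by rewrite card_exceedance_pairs sum_exceedances.
exact: eq_card_bij eq_cards.
Qed.
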